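(* For every $\eta>0$ there are constants $c_\eta,L_\eta>0$ such that, for all sufficiently large integers $r$ (in terms of $\eta$), the following holds. If $G$ is a graph with $$\chi(G)\ge r,\qquad e(G)\le c_\eta r^3\log^2 r,\qquad \mathrm t(G)<\binom r3,$$ then $G$ has an induced subgraph $H$ satisfying $$\chi(H)\ge(1-\eta)r,\qquad |H|\le L_\eta r.$$ Moreover, $H$ may be chosen with bounded independence number, where the bound depends only on $\eta$ (that is, there is a constant $K_\eta$ depending only on $\eta$ such that $H$ can be chosen to satisfy, in addition, $\alpha(H)\le K_\eta$).
   Context: All graphs are finite and simple. $\chi(G)$ is the chromatic number, $e(G)$ the number of edges, $\mathrm t(G)$ the number of triangles, $\alpha(G)$ the independence number, and $|G|$ the number of vertices of $G$. $\log$ is the natural logarithm and $\log^2 r=(\log r)^2$. *)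

(* Defs.v *)
From mathcomp Require Import all_boot.

Set Implicit Arguments.
Unset Strict Implicit.
Unset Printing Implicit Defensive.

Record sgraph := SGraph {
  vertex :> finType;
  adj : rel vertex;
  adj_sym : symmetric adj;
  adj_irr : irreflexive adj }.

Section Graph.
Variable G : sgraph.
Implicit Types (S : {set G}) (k : nat).

Definition colorable k :=
  [exists f : {ffun G -> 'I_k}, forall x, forall y, adj x y ==> (f x != f y)].

Lemma colorable_card : colorable #|G|.
Proof.
apply/existsP; exists [ffun x => enum_rank x].
apply/forallP=> x; apply/forallP=> y; apply/implyP=> xy.
rewrite !ffunE (inj_eq enum_rank_inj).
by apply: contraTneq xy => ->; rewrite adj_irr.
Qed.

Definition chromatic_number : nat :=
  ex_minn (ex_intro (fun k => colorable k) #|G| colorable_card).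

Definition edges : {set {set G}} :=
  [set [set p.1; p.2] | p in [pred p : G * G | adj p.1 p.2]].

Definition clique S := [forall x in S, forall y in S, (x != y) ==> adj x y].

Definition triangles : {set {set G}} :=
  [set S : {set G} | (#|S| == 3) && clique S].

Definition independent S := [forall x in S, forall y in S, ~~ adj x y].

Definition independence_number : nat :=
  \max_(S : {set G} | independent S) #|S|.

Definition induced_adj S : rel {x : G | x \in S} :=
  fun x y => adj (val x) (val y).

Lemma induced_adj_sym S : symmetric (@induced_adj S).
Proof. by move=> x y; apply: adj_sym. Qed.

Lemma induced_adj_irr S : irreflexive (@induced_adj S).
Proof. by move=> x; apply: adj_irr. Qed.

Definition induced_subgraph S : sgraph :=
  SGraph (@induced_adj_sym S) (@induced_adj_irr S).

End Graph.

(* Main.v *)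
Require Import Defs.
From mathcomp Require Import all_boot all_order all_algebra.
From mathcomp Require Import ring lra zify.
From mathcomp Require Import boolp reals sequences exp.

Set Implicit Arguments.
Unset Strict Implicit.
Unset Printing Implicit Defensive.

Import Order.TTheory GRing.Theory Num.Theory.
Local Open Scope ring_scope.

(** Fix a vertex set [S]. Let [tri S v] be the number of ordered adjacent pairs of
    neighbours of [v], and give [v] the weight [tri S v + mu * deg S v], with [mu] of
    order [1 / ln r ^+ 2]. The hypotheses on edges and triangles make the total weight
    of [G] at most [5 * r ^+ 3]. Only [O(s ^+ 2 * r)] vertices can have
    [tri > r ^+ 2 / s ^+ 2]; the subgraph sought is cut out of this set [T].

    The main point is that all other vertices together can be coloured with
    [eps * r] colours ([colorable_on_sparse]). Then [T] has chromatic number at least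
    [(1 - eps) * r]. Removing from [T] disjoint independent sets of more than [K]
    vertices, with [K] of order [s ^+ 2 / eps], costs another [eps * r] colours, and
    what is left has bounded independence number and [O(r)] vertices.

    For the colouring, colour classes are removed one at a time. Deleting vertices
    never increases a weight, so a colour class [I] lowers the total weight by at least
    the weight of [I]. It suffices to find, whenever the total weight is at least
    [delta * rho ^+ 3] and every [tri] is at most [rho ^+ 2 / s ^+ 2], an independent set
    of weight [K * rho ^+ 2] ([heavy_independent_exists]). With [rho = r] and [K] large,
    few colours bring the total weight down to [(g * r) ^+ 3] for a small constant [g].
    From there [rho] decreases along with the weight: a vertex with
    [tri > rho ^+ 2 / s ^+ 2] is itself a colour class of weight of order [rho ^+ 2], so
    every colour lowers the cube root of the total weight by a constant, and
    [O(g * r)] colours suffice ([colorable_on_cube]). When almost no weight is left, the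
    remaining edges are too few to matter ([colorable_on_light]).

    To find the heavy independent set, look at the neighbours of [v] that are at least
    as heavy as [v]. If there are many of them for some [v], Turan's bound gives a heavy
    independent set among them ([heavy_back]). If there are few for every [v], then the
    order by decreasing weight is a degenerate order in which the earlier
    neighbours of every vertex span few edges. A random process along this order, due to
    Martinsson for triangle-free degenerate graphs, accepts every vertex with
    probability at least [p / 2], where [p] beats the greedy bound by the logarithm of
    the sparsity ([heavy_of_small_back]). Its expected weight is large enough. *)

(** * Counts and colourings inside a vertex set *)
Section Counts.
Variable G : sgraph.
Implicit Types (S A B C N I : {set G}) (v x y : G) (k : nat).

Definition nbr S v : {set G} := [set x in S | adj v x].
Definition deg S v := #|nbr S v|.
(** Ordered pairs of adjacent common neighbours, so twice the number of triangles
    at [v]: ordered counts keep factors of two out of every later bound. *)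
Definition tri S v := (\sum_(x in nbr S v) deg (nbr S v) x)%N.

Lemma nbrS A B v : A \subset B -> nbr A v \subset nbr B v.
Proof.
move=> sAB; apply/subsetP=> x; rewrite !inE => /andP[xA ->].
by rewrite (subsetP sAB).
Qed.

Lemma nbr_sub A v : nbr A v \subset A.
Proof. by apply/subsetP=> x; rewrite inE => /andP[]. Qed.

Lemma degS A B v : A \subset B -> (deg A v <= deg B v)%N.
Proof. by move=> sAB; apply/subset_leq_card/nbrS. Qed.

Lemma sum_degS A B C (D : {set G}) : A \subset B -> C \subset D ->
  (\sum_(x in A) deg C x <= \sum_(x in B) deg D x)%N.
Proof.
move=> sAB sCD; rewrite [leqRHS](big_setID A) /= (setIidPr sAB).
by apply: leq_trans (leq_addr _ _); apply: leq_sum => x _; apply: degS.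
Qed.

Lemma triS A B v : A \subset B -> (tri A v <= tri B v)%N.
Proof. by move=> sAB; apply: sum_degS; apply: nbrS. Qed.

Lemma independentP S :
  reflect {in S &, forall x y, ~~ adj x y} (independent S).
Proof.
apply: (iffP forall_inP) => [h x y xS yS | h x xS].
  by move/forall_inP: (h _ xS); apply.
by apply/forall_inP => y; apply: h.
Qed.

Lemma independent1 v : independent [set v].
Proof. by apply/independentP => x y /set1P-> /set1P->; rewrite adj_irr. Qed.

(** Colourings of a vertex set rather than of an induced subgraph, with natural
    numbers as colours, so that colour classes can be removed and colourings glued
    without changing types. *)
Definition colorable_on S k := exists f : G -> nat,
  {in S, forall x, (f x < k)%N} /\ {in S &, forall x y, adj x y -> f x <> f y}.

Lemma colorable_on_mono S k m : (k <= m)%N -> colorable_on S k -> colorable_on S m.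
Proof.
move=> km [f [f1 f2]]; exists f; split=> // x xS.
exact: leq_trans (f1 _ xS) km.
Qed.

Lemma colorable_on_sub A B k : A \subset B -> colorable_on B k -> colorable_on A k.
Proof.
move=> /subsetP sAB [f [f1 f2]]; exists f; split=> [x /sAB /f1 //|].
by move=> x y /sAB xB /sAB yB; apply: f2.
Qed.

Lemma colorable_on_U A B k m :
  colorable_on A k -> colorable_on B m -> colorable_on (A :|: B) (k + m).
Proof.
move=> [f [f1 f2]] [g [g1 g2]].
exists (fun x => if x \in A then f x else k + g x)%N; split.
  move=> x; rewrite inE; case: ifP => [xA _|_ /= xB].
    by rewrite (leq_trans (f1 _ xA)) ?leq_addr.
  by rewrite ltn_add2l g1.
move=> x y; rewrite !inE.
case: ifP => xA; case: ifP => yA //= xB yB xy.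
- exact: f2.
- by move=> e; have := f1 _ xA; rewrite e ltnNge leq_addr.
- by move=> e; have := f1 _ yA; rewrite -e ltnNge leq_addr.
- by move=> /addnI; apply: g2.
Qed.

Lemma colorable_on_card S : colorable_on S #|S|.
Proof.
exists (fun x => index x (enum S)); split=> [x xS|x y xS yS xy e].
  by rewrite cardE index_mem mem_enum.
have := nth_index x (s := enum S) (x := x).
rewrite mem_enum => /(_ xS); rewrite e nth_index ?mem_enum // => yx.
by move: xy; rewrite yx adj_irr.
Qed.

Lemma colorable_on_independent S : independent S -> colorable_on S 1.
Proof.
move=> /independentP iS; exists (fun=> 0%N); split=> // x y xS yS.
by rewrite (negbTE (iS _ _ xS yS)).
Qed.

Lemma colorable_on_rm S I k :
  independent I -> colorable_on (S :\: I) k -> colorable_on S k.+1.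
Proof.
move=> /colorable_on_independent c1 /(colorable_on_U c1); rewrite add1n.
apply: colorable_on_sub.
by apply/subsetP=> x xS; rewrite !inE xS andbT; case: (x \in I).
Qed.

Lemma colorable_on_extend S v k : v \in S -> (deg S v < k)%N ->
  colorable_on (S :\ v) k -> colorable_on S k.
Proof.
move=> vS dv [f [f1 f2]].
have [c ck cN] : exists2 c, (c < k)%N & forall x, x \in nbr S v -> f x <> c.
  have : has (fun c => c \notin [seq f x | x <- enum (nbr S v)]) (iota 0 k).
    rewrite has_predC; apply/negP => /allP sub.
    have := uniq_leq_size (iota_uniq 0 k) sub.
    by rewrite size_iota size_map -cardE leqNgt dv.
  case/hasP => c; rewrite mem_iota => /andP[_ ck] cN; exists c => //.
  by move=> x xN e; move/mapP: cN; apply; exists x; rewrite ?mem_enum.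
exists (fun x => if x == v then c else f x); split.
  by move=> x xS; case: eqP => // /eqP xv; apply: f1; rewrite !inE xv.
move=> x y xS yS xy; case: eqP => [xv|/eqP xv]; case: eqP => [yv|/eqP yv].
- by move: xy; rewrite xv yv adj_irr.
- by move=> e; apply: (cN y) => //; rewrite inE yS -xv.
- by apply: cN; rewrite inE xS -yv adj_sym.
- by apply: f2 => //; rewrite !inE ?xv ?yv.
Qed.

(** A vertex of degree below [k] can be coloured last; without one, the degree sum
    bounds the number of vertices by [k], and all of them may get distinct colours. *)
Lemma colorable_on_edges S k : (0 < k)%N ->
  (\sum_(x in S) deg S x <= k * k)%N -> colorable_on S k.
Proof.
move=> k0; elim: {S}_.+1 {-2}S (ltnSn #|S|) => // n IH S.
rewrite ltnS => cS eS.
case: (boolP [exists x in S, (deg S x < k)%N]) => [/exists_inP[v vS dv]|].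
  apply: (colorable_on_extend vS dv); apply: IH.
    by rewrite (leq_trans _ cS) // [in leqRHS](cardsD1 v S) vS.
  by apply: leq_trans eS; apply: sum_degS; apply: subD1set.
rewrite negb_exists_in => /forall_inP h.
apply: (@colorable_on_mono _ #|S|); last exact: colorable_on_card.
rewrite -(leq_pmul2r k0); apply: leq_trans eS.
by rewrite -sum_nat_const; apply: leq_sum => x xS; rewrite leqNgt h.
Qed.

(** The closed neighbourhoods of a maximal independent set cover [N]. *)
Lemma independent_cover N k : {in N, forall x, (deg N x <= k)%N} ->
  exists2 I : {set G}, I \subset N /\ independent I & (#|N| <= #|I| * k.+1)%N.
Proof.
move=> dN; pose P (I : {set G}) := (I \subset N) && independent I.
have P0 : P set0.
  by rewrite /P sub0set; apply/independentP => x y; rewrite inE.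
have [I /maxsetP[/andP[sIN iI] Imax] _] := @maxset_exists _ P set0 P0.
exists I; first by split.
have sub : N \subset \bigcup_(x in I) (x |: nbr N x).
  apply/subsetP => y yN; apply: contraT => yn.
  have yI : y \notin I.
    by apply: contra yn => yI; apply/bigcupP; exists y; rewrite // !inE eqxx.
  have nad x : x \in I -> ~~ adj x y.
    move=> xI; apply: contra yn => xy.
    by apply/bigcupP; exists x; rewrite // !inE yN xy orbT.
  case/negP: yI; rewrite -(Imax (y |: I)) ?setU11 ?subsetUr //.
  rewrite /P subUset sub1set yN sIN; apply/independentP => a b.
  rewrite !inE => /predU1P[->|aI] /predU1P[->|bI].
  - by rewrite adj_irr.
  - by rewrite adj_sym nad.
  - exact: nad.
  - by move/independentP: iI; apply.
apply: leq_trans (subset_leq_card sub) _.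
have cardU : (#|\bigcup_(x in I) (x |: nbr N x)| <= \sum_(x in I) k.+1)%N.
  elim/big_rec2: _ => [|x m A xI h]; first by rewrite cards0.
  rewrite (leq_trans (leq_card_setU _ _).1) // leq_add // cardsU1.
  by rewrite -add1n leq_add ?leq_b1 // dN // (subsetP sIN).
by rewrite -sum_nat_const.
Qed.

(** Turan's bound up to a factor two: at least half of [N] has degree at most twice
    the average, and a maximal independent set of that half is large. *)
Lemma independent_turan N :
  exists2 I : {set G}, I \subset N /\ independent I &
    (#|N| * #|N| <= 2 * #|I| * (#|N| + 2 * \sum_(x in N) deg N x))%N.
Proof.
set t := (\sum_(x in N) _)%N; set D := #|N|.
case: (posnP D) => [D0|D0].
  exists set0; last by rewrite D0.
  by rewrite sub0set; split=> //; apply/independentP => x y; rewrite inE.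
pose N' := [set u in N | (deg N u * D <= 2 * t)%N].
have sN : N' \subset N by apply/subsetP => u; rewrite inE => /andP[].
have cB : (#|N :\: N'| * (2 * t).+1 <= t * D)%N.
  rewrite -sum_nat_const /t [in leqRHS](big_setID N') /= mulnDl.
  rewrite (leq_trans _ (leq_addl _ _)) // big_distrl /=.
  apply: leq_sum => u; rewrite !inE => /andP[+ uN]; rewrite uN /=.
  by rewrite -ltnNge.
have cN' : (D <= 2 * #|N'|)%N.
  have := cardsID N' N; rewrite (setIidPr sN) -/D.
  by clear -cB; nia.
have [|I [sI iI] cI] := @independent_cover N' (2 * t %/ D).
  move=> u uN'; apply: leq_trans (degS u sN) _; rewrite leq_divRL //.
  by move: uN'; rewrite inE => /andP[].
exists I; first by split=> //; apply: subset_trans sI sN.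
have := leq_divM (2 * t) D.
move: cI cN'; set q := (_ %/ _)%N => cI cN' hq.
have h1 : (D * D <= 2 * #|N'| * D)%N by rewrite leq_mul2r cN' orbT.
have h2 : (#|N'| * D <= #|I| * q.+1 * D)%N by rewrite leq_mul2r cI orbT.
have h3 : (#|I| * (q * D) <= #|I| * (2 * t))%N by rewrite leq_mul2l hq orbT.
by clear -h1 h2 h3; nia.
Qed.

Section Weights.
Variables (R : realType) (mu : R).
Hypothesis mu_ge0 : 0 <= mu.

(** The triangle term drives the argument where triangles abound; the edge term
    gives weight to vertices in few or no triangles, for which the bound on the
    number of edges is the only information. *)
Definition wt S v : R := (tri S v)%:R + mu * (deg S v)%:R.
Definition total_wt S : R := \sum_(v in S) wt S v.

Lemma wt_ge0 S v : 0 <= wt S v.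
Proof. by rewrite addr_ge0 ?mulr_ge0. Qed.

Lemma wtS A B v : A \subset B -> wt A v <= wt B v.
Proof.
by move=> sAB; rewrite lerD ?ler_wpM2l ?ler_nat ?triS ?degS.
Qed.

(** Deleting [I] removes the summands of [I], and no remaining summand grows. *)
Lemma total_wt_rm S I : I \subset S ->
  total_wt (S :\: I) <= total_wt S - \sum_(v in I) wt S v.
Proof.
move=> sI; rewrite [total_wt S](big_setID I) /= (setIidPr sI) addrC addrK.
by apply: ler_sum => v _; apply/wtS/subsetDl.
Qed.

Lemma total_wtS A B : A \subset B -> total_wt A <= total_wt B.
Proof.
move=> sAB; rewrite [total_wt B](big_setID A) /= (setIidPr sAB) -[total_wt A]addr0.
apply: lerD; first by apply: ler_sum => v _; apply: wtS.
by apply: sumr_ge0 => v _; apply: wt_ge0.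
Qed.

(** Greedy colouring along levels [a 0], [a 1], ... of the total weight: a colour
    class heavy enough to bridge one level costs one colour, so a set at level [n]
    costs [n] colours on top of what level [0] needs. *)
Lemma colorable_on_greedy (P : {set G} -> Prop) (k n : nat) (a : nat -> R) S :
  (forall A B, A \subset B -> P B -> P A) ->
  (forall A, P A -> total_wt A <= a 0 -> colorable_on A k) ->
  (forall A m, P A -> (m < n)%N -> a m < total_wt A <= a m.+1 ->
     exists I : {set G}, [/\ I \subset A, independent I &
       a m.+1 - a m <= \sum_(v in I) wt A v]) ->
  P S -> total_wt S <= a n -> colorable_on S (n + k).
Proof.
move=> PS h0; elim: n S => [|n IH] S h1 pS pa; first exact: h0.
have h1' A m : P A -> (m < n)%N -> a m < total_wt A <= a m.+1 ->
     exists I : {set G}, [/\ I \subset A, independent I &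
       a m.+1 - a m <= \sum_(v in I) wt A v].
  by move=> pA mn; apply: h1 => //; apply: ltnW.
case: (leP (total_wt S) (a n)) => [le|lt].
  by apply: colorable_on_mono (IH _ h1' pS le); rewrite leq_add2r.
have [|I [sI iI bI]] := h1 S n pS (ltnSn n); first by rewrite lt.
rewrite addSn; apply: (colorable_on_rm iI); apply: IH h1' _ _.
  by apply: PS pS; apply: subsetDl.
apply: le_trans (total_wt_rm sI) _; lra.
Qed.
End Weights.
End Counts.

(** * A random process selecting an independent set *)
Section Process.
Variables (G : sgraph) (R : realType) (p : R) (cap : G -> R).
Hypothesis p_gt0 : 0 < p.
Hypothesis p_cap : forall v, p < cap v.
Hypothesis cap_half : forall v, cap v <= 2^-1.
Implicit Types (W : G -> R) (F : (G -> R) -> R) (u v x : G) (s : seq G).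

(** The process scans the vertices in a list; its state [W] gives every vertex a
    value, initially [p]. The scanned vertex [u] is accepted with probability [W u],
    or never if [W u] exceeds [cap u]. Acceptance sends its neighbours to [0];
    rejection divides them by the probability of rejection, so that every value is
    a martingale. The cap keeps that division harmless. *)
Definition acc_prob u W := if W u <= cap u then W u else 0.
Definition accept u W v := if adj u v then 0 else W v.
Definition reject u W v := if adj u v then W v / (1 - acc_prob u W) else W v.
Definition step u F W :=
  acc_prob u W * F (accept u W) + (1 - acc_prob u W) * F (reject u W).
(** The expectation of [F] at the final state, as an operator on functions of the
    initial state: the recursion conditions on what happens to the first vertex. *)
Definition expect s F := foldr step F s.
(** A value never lies strictly between [0] and [p]: rejections only increase it. *)
Definition live W := forall v, W v = 0 \/ p <= W v.

Lemma live_ge0 W v : live W -> 0 <= W v.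
Proof. by move=> /(_ v) [->//|]; apply: le_trans; apply: ltW. Qed.

Lemma cap_gt0 v : 0 < cap v. Proof. exact: lt_trans p_gt0 (p_cap v). Qed.

Lemma acc_prob_ge0 W u : live W -> 0 <= acc_prob u W.
Proof. by move=> lW; rewrite /acc_prob; case: ifP => // _; apply: live_ge0. Qed.

Lemma acc_prob_le_cap W u : acc_prob u W <= cap u.
Proof. by rewrite /acc_prob; case: ifP => // _; apply/ltW/cap_gt0. Qed.

Lemma acc_prob_le W u : live W -> acc_prob u W <= W u.
Proof. by move=> lW; rewrite /acc_prob; case: ifP => // _; apply: live_ge0. Qed.

Lemma acc_prob_half W u : acc_prob u W <= 2^-1.
Proof. exact: le_trans (acc_prob_le_cap W u) (cap_half u). Qed.

Lemma rejp_gt0 W u : 0 < 1 - acc_prob u W.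
Proof. by have := acc_prob_half W u; lra. Qed.

Lemma rejp_inv W u : live W -> (1 - acc_prob u W)^-1 <= 1 + 2 * acc_prob u W.
Proof.
move=> lW; rewrite -[_^-1]mul1r ler_pdivrMr ?rejp_gt0 //.
by have := acc_prob_half W u; have := acc_prob_ge0 u lW; nra.
Qed.

Lemma live_accept W u : live W -> live (accept u W).
Proof. by move=> lW v; rewrite /accept; case: ifP => _; [left | apply: lW]. Qed.

Lemma live_reject W u : live W -> live (reject u W).
Proof.
move=> lW v; rewrite /reject; case: ifP => _; last exact: lW.
case: (lW v) => [->|pW]; [by left; rewrite mul0r | right].
rewrite ler_pdivlMr ?rejp_gt0 // mulrBr mulr1; apply: le_trans pW.
by rewrite gerBl mulr_ge0 ?(ltW p_gt0) ?acc_prob_ge0.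
Qed.

Lemma step_le u F F' W : live W -> (forall W', live W' -> F W' <= F' W') ->
  step u F W <= step u F' W.
Proof.
move=> lW h; rewrite /step lerD // ler_wpM2l ?acc_prob_ge0 ?(ltW (rejp_gt0 _ _)) //.
  exact/h/live_accept.
exact/h/live_reject.
Qed.

Lemma expect_le s F F' W : live W -> (forall W', live W' -> F W' <= F' W') ->
  expect s F W <= expect s F' W.
Proof.
by elim: s W => [|u s IH] W lW h /=; [apply: h|apply: step_le => // *; apply: IH].
Qed.

Lemma expect_rcons s u F : expect (rcons s u) F = expect s (step u F).
Proof. by rewrite /expect foldr_rcons. Qed.

Lemma expect_lin s (a b : R) F F' W :
  expect s (fun W => a * F W + b * F' W) W = a * expect s F W + b * expect s F' W.
Proof. by elim: s W => [//|u s IH] W /=; rewrite /step !IH; ring. Qed.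

Lemma expect_W s v W : live W -> expect s (fun W => W v) W = W v.
Proof.
elim: s W => [//|u s IH] W lW /=.
rewrite /step IH ?IH; [|exact: live_reject|exact: live_accept].
rewrite /accept /reject; have := rejp_gt0 W u; case: ifP => _ h.
  by field; rewrite gt_eqF.
by ring.
Qed.

(** Only a scanned common neighbour of [u] and [v] correlates their values: its
    rejection divides both by the same factor. Few common neighbours among the
    scanned vertices therefore make the two values nearly uncorrelated. *)
Lemma expect_WW s u v W (c : R) : live W -> {in s, forall x, cap x <= c} ->
  expect s (fun W => W u * W v) W <=
    W u * W v * (1 + 2 * c) ^+ count (fun x => adj x u && adj x v) s.
Proof.
elim: s W => [|x s IH] W lW capc /=; first by rewrite expr0 mulr1.
have capc' : {in s, forall x, cap x <= c}.
  by move=> y ys; apply: capc; rewrite inE ys orbT.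
have cx : cap x <= c by apply: capc; rewrite inE eqxx.
have c0 : 0 < c by apply: lt_le_trans cx; apply: cap_gt0.
set k := count _ s; rewrite exprD mulrA.
have := step_le x lW (fun W' lW' => IH W' lW' capc').
rewrite -/k => /le_trans; apply.
rewrite /step [X in X + _]mulrA [X in _ + X]mulrA -mulrDl.
rewrite ler_wpM2r ?exprn_ge0 //; first lra.
have Wu := live_ge0 u lW; have Wv := live_ge0 v lW.
have a0 := acc_prob_ge0 x lW; have r0 := rejp_gt0 W x; have ri := rejp_inv x lW.
have ac := acc_prob_le_cap W x.
rewrite /accept /reject; set a := acc_prob x W in a0 r0 ri ac *.
case: (adj x u); case: (adj x v) => /=; rewrite ?expr0 ?expr1 ?mul0r ?mulr0 ?add0r.
- have -> : (1 - a) * (W u / (1 - a) * (W v / (1 - a))) =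
      W u * W v * (1 - a)^-1 by field; rewrite gt_eqF.
  rewrite ler_wpM2l ?mulr_ge0 //; apply: le_trans ri _; lra.
- have -> // : (1 - a) * (W u / (1 - a) * W v) = W u * W v * 1.
  by field; rewrite gt_eqF.
- have -> // : (1 - a) * (W u * (W v / (1 - a))) = W u * W v * 1.
  by field; rewrite gt_eqF.
- by rewrite -mulrDl addrC subrK mul1r mulr1.
Qed.

(** Its mean is [p] times the expectation of [ln (W v / p)] under the law biased by
    [W v / p]; a value above the cap makes it large. *)
Definition entropy v W := W v * ln (W v / p).

Lemma step_entropy u v W : live W ->
  step u (entropy v) W <=
    entropy v W + (if adj u v then 2 * (acc_prob u W * W v) else 0).
Proof.
move=> lW; rewrite /step /entropy /accept /reject.
have a0 := acc_prob_ge0 u lW; have r0 := rejp_gt0 W u; have ri := rejp_inv u lW.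
set a := acc_prob u W in a0 r0 ri *.
case: (adj u v); last by rewrite addr0 -mulrDl addrC subrK mul1r.
rewrite mul0r mulr0 add0r; case: (lW v) => [->|pW]; first by rewrite !mul0r !mulr0 addr0.
have W0 : 0 < W v by apply: lt_le_trans pW.
have -> : W v / (1 - a) / p = (W v / p) * (1 - a)^-1 by rewrite mulrAC.
rewrite lnM ?posrE ?divr_gt0 ?invr_gt0 //.
have l1 : ln (1 - a)^-1 <= 2 * a.
  have : ln (1 - a)^-1 <= ln (1 + 2 * a).
    by rewrite ler_ln ?posrE ?invr_gt0 //; lra.
  move=> /le_trans; apply; apply: le_trans (le_ln1Dx _) _ => //; lra.
have -> : (1 - a) * (W v / (1 - a) * (ln (W v / p) + ln (1 - a)^-1)) =
   W v * ln (W v / p) + W v * ln (1 - a)^-1 by field; rewrite gt_eqF.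
by rewrite lerD2l (_ : 2 * (a * W v) = W v * (2 * a)) ?ler_pM2l //; ring.
Qed.

(** The entropy of [v] grows only when a neighbour [u] is scanned, and then, as
    [- ln (1 - q) <= 2 q], by at most [2 q W v] on average. *)
Lemma expect_entropy s v (g : G -> R) W : live W ->
  (forall s1 u s2, s = s1 ++ u :: s2 -> adj u v ->
     expect s1 (fun W => acc_prob u W * W v) W <= g u) ->
  expect s (entropy v) W <= entropy v W + 2 * \sum_(u <- s | adj u v) g u.
Proof.
move=> lW; elim/last_ind: s => [|s u IH] h; first by rewrite big_nil mulr0 addr0.
have {}IH : expect s (entropy v) W <= entropy v W + 2 * \sum_(u <- s | adj u v) g u.
  apply: IH => s1 x s2 e; apply: (h s1 x (rcons s2 u)).
  by rewrite e rcons_cat rcons_cons.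
rewrite expect_rcons big_rcons /= mulrDr addrA.
apply: (@le_trans _ _ (expect s (entropy v) W + 2 * (if adj u v then g u else 0)));
  last by rewrite lerD2r.
apply: le_trans (expect_le s lW (fun W' lW' => step_entropy u v lW')) _.
case: ifP => uv.
  rewrite (_ : expect s _ W =
    1 * expect s (entropy v) W + 2 * expect s (fun W => acc_prob u W * W v) W).
    by rewrite mul1r lerD2l ler_pM2l // (h s u [::]) // cats1.
  by rewrite -expect_lin; congr expect; apply/funext => W'; rewrite mul1r.
rewrite mulr0 addr0 le_eqVlt; apply/orP; left; apply/eqP.
by congr expect; apply/funext => W'; rewrite addr0.
Qed.

Let W0 : G -> R := fun=> p.

Lemma live0 : live W0. Proof. by right. Qed.

(** The mean of [W v] is [p], and the acceptance probability differs from [W v] only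
    above the cap, where [W v] is at most [entropy v W / ln (cap v / p)]. *)
Lemma expect_acc_prob s v (B : R) :
  expect s (entropy v) W0 <= B -> 2 * B <= p * ln (cap v / p) ->
  p / 2 <= expect s (acc_prob v) W0.
Proof.
move=> eB bB; set L := ln (cap v / p) in bB *.
have L0 : 0 < L by rewrite ln_gt0 // ltr_pdivlMr // mul1r.
have key W : live W -> L * W v + (-1) * entropy v W <= L * acc_prob v W.
  move=> lW; rewrite /acc_prob /entropy; case: (leP (W v) (cap v)) => [le|lt].
    rewrite gerDl mulN1r oppr_le0.
    case: (lW v) => [->|pW]; first by rewrite mul0r.
    by rewrite mulr_ge0 ?(live_ge0 v lW) // ln_ge0 // ler_pdivlMr // mul1r.
  rewrite mulr0 mulN1r subr_le0 mulrC ler_wpM2l ?(live_ge0 v lW) //.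
  have c0 := cap_gt0 v; have w0 := lt_trans c0 lt.
  by rewrite /L ler_ln ?posrE ?divr_gt0 // ler_pM2r ?invr_gt0 // ltW.
have := expect_le s live0 key; rewrite expect_lin (expect_W _ _ live0).
have -> : expect s (fun W => L * acc_prob v W) W0 = L * expect s (acc_prob v) W0.
  have := expect_lin s L 0 (acc_prob v) (acc_prob v) W0; rewrite mul0r addr0 => <-.
  by congr expect; apply/funext => W'; rewrite mul0r addr0.
rewrite {1}/W0 => h; rewrite -(ler_pM2l L0).
apply: le_trans h; lra.
Qed.

Section Value.
Variable c : G -> R.

(** The expected total [c]-weight of the accepted vertices. *)
Fixpoint value s W :=
  if s is u :: s' then acc_prob u W * c u + step u (value s') W else 0.

(** Following at each vertex the better of its two branches turns the expectation
    into one accepted set. It is independent because a neighbour of an accepted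
    vertex has value [0] and stays there. *)
Lemma value_reached s W : uniq s -> live W ->
  exists J : {set G}, [/\ independent J, {in J, forall x, x \in s /\ W x != 0} &
    value s W <= \sum_(x in J) c x].
Proof.
elim: s W => [|u s IH] W /=.
  move=> _ _; exists set0; split; last by rewrite big_set0.
    by apply/independentP => x y; rewrite inE.
  by move=> x; rewrite inE.
case/andP => us Us lW.
have [J2 [i2 m2 v2]] := IH _ Us (live_reject u lW).
have rejJ : {in J2, forall x, x \in u :: s /\ W x != 0}.
  move=> x /m2[xs]; rewrite /reject inE xs orbT; split=> //.
  by move: b; case: ifP => // _; apply: contra => /eqP->; rewrite mul0r.
have r0 := rejp_gt0 W u; have a0 := acc_prob_ge0 u lW.
case: (eqVneq (acc_prob u W) 0) => [q0|qN0].
  exists J2; split=> //.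
  by rewrite /step q0 !mul0r !add0r subr0 mul1r.
have [J1 [i1 m1 v1]] := IH _ Us (live_accept u lW).
have uJ1 : u \notin J1 by apply/negP => /m1[]; rewrite (negbTE us).
have iU : independent (u |: J1).
  have nad x : x \in J1 -> ~~ adj u x.
    by move=> /m1[_]; rewrite /accept; case: ifP => //; rewrite eqxx.
  apply/independentP => a b; rewrite !inE => /predU1P[->|aI] /predU1P[->|bI].
  - by rewrite adj_irr.
  - exact: nad.
  - by rewrite adj_sym nad.
  - by move/independentP: i1; apply.
have mU : {in u |: J1, forall x, x \in u :: s /\ W x != 0}.
  move=> x; rewrite !inE => /predU1P[->|/m1[xs]].
    rewrite eqxx; split=> //; apply: contra qN0 => /eqP W0u.
    by rewrite /acc_prob W0u if_same.
  rewrite xs orbT; split=> //; move: b; rewrite /accept.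
  by case: ifP => //; rewrite eqxx.
rewrite /step.
case: (leP (c u + value s (accept u W)) (value s (reject u W))) => cmp.
  exists J2; split=> //; nra.
exists (u |: J1); split=> //; rewrite big_setU1 //=; nra.
Qed.

Lemma expect_value s1 s2 (b : R) : {in s2, forall x, 0 <= c x} ->
  (forall t1 u t2, s1 ++ s2 = t1 ++ u :: t2 -> u \in s2 ->
     b <= expect t1 (acc_prob u) W0) ->
  b * (\sum_(u <- s2) c u) <= expect s1 (value s2) W0.
Proof.
elim: s2 s1 => [|u s2 IH] s1 c0 h.
  rewrite big_nil mulr0 le_eqVlt; apply/orP; left; apply/eqP.
  have := expect_lin s1 0 0 (value [::]) (value [::]) W0; rewrite !mul0r addr0 => <-.
  by congr expect; apply/funext => W'; rewrite !mul0r addr0.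
rewrite big_cons mulrDr.
have -> : expect s1 (value (u :: s2)) W0 =
   c u * expect s1 (acc_prob u) W0 + 1 * expect (rcons s1 u) (value s2) W0.
  rewrite expect_rcons -expect_lin; congr expect; apply/funext => W'.
  by rewrite mul1r mulrC.
rewrite mul1r; apply: lerD.
  rewrite mulrC ler_wpM2l ?c0 ?inE ?eqxx //.
  by apply: (h s1 u s2); rewrite // inE eqxx.
apply: IH => [x xs|t1 x t2]; first by rewrite c0 // inE xs orbT.
by rewrite cat_rcons => /h hx xs; apply: hx; rewrite inE xs orbT.
Qed.
End Value.
End Process.

(** * Heavy independent sets in locally sparse degenerate graphs *)
Section Heavy.
Variables (G : sgraph) (R : realType).
Implicit Types (S : {set G}) (u v : G).

(** The neighbours at least as heavy as [v]. Scanning by decreasing weight, they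
    contain every neighbour scanned before [v]; with ties included, the set does not
    depend on how the order breaks them. *)
Definition back S (w : G -> R) v : {set G} := [set u in nbr S v | w v <= w u].

Lemma exprn_1Dx_le (x : R) k : 0 <= x -> (1 + x) ^+ k <= expR (x * k%:R).
Proof.
move=> x0; rewrite expRM_natr; apply: lerXn2r.
- by rewrite nnegrE; lra.
- by rewrite nnegrE expR_ge0.
- exact: expR_ge1Dx.
Qed.

(** Scan [S] by decreasing [w]. Few edges among the heavy neighbours of [v] mean that
    their values are hardly correlated with that of [v], so that the entropy of [v]
    stays small and [v] is accepted with probability at least [p / 2]. For
    triangle-free degenerate graphs this is Martinsson's argument; here the term
    [cap v ^+ 2 * tri S v] pays for the triangles. *)
Lemma heavy_of_small_back (p : R) (cap w : G -> R) S :
  0 < p -> (forall v, p < cap v) -> (forall v, cap v <= 2^-1) ->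
  (forall u v, w v <= w u -> cap u <= cap v) ->
  {in S, forall v, 0 <= w v} ->
  {in S, forall v, expR 2 * p * #|back S w v|%:R + cap v ^+ 2 * (tri S v)%:R
     <= ln (cap v / p) / 4} ->
  exists I : {set G}, [/\ I \subset S, independent I &
     p / 2 * (\sum_(v in S) w v) <= \sum_(v in I) w v].
Proof.
move=> p0 pcap caph capm w0 H.
pose r := [rel x y | w y <= w x].
pose s := sort r (enum S).
have rt : transitive r by move=> y x z /= xy yz; apply: le_trans yz xy.
have s_sorted : sorted r s by apply: sort_sorted => x y /=; apply: le_total.
have s_uniq : uniq s by rewrite sort_uniq enum_uniq.
have s_mem x : (x \in s) = (x \in S) by rewrite mem_sort mem_enum.
have split_le s1 u s2 x : s = s1 ++ u :: s2 -> x \in s1 -> w u <= w x.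
  move=> e xs1; move: s_sorted; rewrite sorted_pairwise // e pairwise_cat.
  by case/and3P => /allrelP /(_ x u xs1) + _ _; apply; rewrite inE eqxx.
have lW0 : live p (fun _ : G => p) by right.
have main s1 v s2 : s = s1 ++ v :: s2 ->
    p / 2 <= expect cap s1 (acc_prob cap v) (fun=> p).
  move=> e.
  have vS : v \in S by rewrite -s_mem e mem_cat inE eqxx orbT.
  have s1S x : x \in s1 -> x \in S by rewrite -s_mem e mem_cat => ->.
  have s1u : uniq s1 by move: s_uniq; rewrite e cat_uniq => /andP[].
  have cv0 : 0 < cap v by apply: lt_trans (pcap v).
  pose d u := #|nbr (nbr S v) u|.
  pose g u := expR 2 * p ^+ 2 + p * cap v ^+ 2 * (d u)%:R.
  have g0 u : 0 <= g u.
    by rewrite addr_ge0 ?mulr_ge0 ?exprn_ge0 ?expR_ge0 ?(ltW p0) ?(ltW cv0).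
  have entv : expect cap s1 (entropy p v) (fun=> p) <=
      0 + 2 * \sum_(u <- s1 | adj u v) g u.
    have e0 : entropy p v (fun=> p) = 0 by rewrite /entropy divff ?gt_eqF // ln1 mulr0.
    have := @expect_entropy _ _ _ _ p0 pcap caph s1 v g _ lW0; rewrite e0; apply.
    move=> t1 u t2 e1 uv.
    have us1 : u \in s1 by rewrite e1 mem_cat inE eqxx orbT.
    have t1s1 x : x \in t1 -> x \in s1 by rewrite e1 mem_cat => ->.
    have capt1 : {in t1, forall x, cap x <= cap v}.
      by move=> x /t1s1 /(split_le _ _ _ _ e) /capm.
    (* With at most [1 / cap v] common neighbours the correlation costs a factor
       [expR 2]; a vertex [u] with more is paid for by its edges inside the
       neighbourhood of [v]. *)
    case: (leP (cap v * (d u)%:R) 1) => [le|lt].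
      apply: le_trans (_ : expect cap t1 (fun W => W u * W v) (fun=> p) <= _).
        apply: (expect_le p0 pcap caph _ lW0) => W lW.
        apply: ler_wpM2r; first exact: (live_ge0 p0 v lW).
        exact: (acc_prob_le cap p0 u lW).
      apply: le_trans (expect_WW p0 pcap caph u v lW0 capt1) _.
      rewrite /g -[leLHS]addr0; apply: lerD; last first.
        by rewrite mulr_ge0 ?mulr_ge0 ?exprn_ge0 ?(ltW p0) ?(ltW cv0).
      rewrite -expr2 mulrC ler_wpM2r ?exprn_ge0 ?(ltW p0) //.
      apply: le_trans (exprn_1Dx_le _ _) _; first by lra.
      rewrite ler_expR -mulrA ger_pMr //; apply: le_trans le.
      rewrite ler_pM2l // ler_nat -size_filter.
      have fu : uniq [seq x <- t1 | adj x u && adj x v].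
        by rewrite filter_uniq //; move: s1u; rewrite e1 cat_uniq => /andP[].
      rewrite -(card_uniqP fu); apply/subset_leq_card/subsetP => x.
      rewrite mem_filter !inE => /andP[/andP[xu xv] /t1s1 /s1S ->].
      by rewrite adj_sym xv adj_sym xu.
    apply: le_trans (_ : expect cap t1 (fun W => cap v * W v + 0 * W v) (fun=> p) <= _).
      apply: (expect_le p0 pcap caph _ lW0) => W lW; rewrite mul0r addr0.
      rewrite ler_wpM2r ?(live_ge0 p0 v lW) //.
      apply: le_trans (acc_prob_le_cap p0 pcap W u) _.
      by apply: capm; apply: split_le e us1.
    rewrite expect_lin mul0r addr0 (expect_W p0 pcap caph _ _ lW0).
    rewrite /g -[leLHS]add0r; apply: lerD.
      by rewrite mulr_ge0 ?expR_ge0 ?exprn_ge0 ?(ltW p0).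
    rewrite mulrC -mulrA ler_pM2l // expr2 -mulrA ler_peMr ?(ltW cv0) //.
    exact: ltW.
  apply: (expect_acc_prob p0 pcap caph entv).
  have sumg : \sum_(u <- s1 | adj u v) g u <= \sum_(u in back S w v) g u.
    rewrite -big_filter (big_uniq _ (filter_uniq _ s1u)) /=.
    rewrite big_mkcond [leRHS]big_mkcond /=; apply: ler_sum => u _.
    rewrite mem_filter; case: ifP => [/andP[uv us1]|_]; last by case: ifP.
    by rewrite !inE (s1S _ us1) adj_sym uv (split_le _ _ _ _ e us1).
  have sumd : (\sum_(u in back S w v) d u <= tri S v)%N.
    have sb : back S w v \subset nbr S v.
      by apply/subsetP => x; rewrite inE => /andP[].
    by rewrite /tri [leqRHS](big_setID (back S w v)) /= (setIidPr sb) leq_addr.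
  have := H _ vS; rewrite -(ler_pM2l p0).
  have : \sum_(u in back S w v) g u <=
      p * (expR 2 * p * #|back S w v|%:R + cap v ^+ 2 * (tri S v)%:R).
    rewrite big_split /= sumr_const -mulr_sumr mulrDr; apply: lerD.
      by rewrite -mulr_natr; lra.
    rewrite -natr_sum mulrA ler_wpM2l ?ler_nat //.
    by rewrite mulr_ge0 ?exprn_ge0 ?(ltW p0) ?(ltW cv0).
  move: sumg; set A := \sum_(u <- _ | _) _; set B := \sum_(u in _) _.
  set C := p * (_ + _); lra.
have [J [iJ mJ vJ]] := value_reached p0 pcap caph w s_uniq lW0.
exists J; split=> //.
  by apply/subsetP => x /mJ[]; rewrite s_mem.
apply: le_trans vJ.
have := @expect_value G R p cap w [::] s (p / 2).
have -> : \sum_(v in S) w v = \sum_(u <- s) w u.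
  by rewrite (big_uniq _ s_uniq); apply: eq_bigl => x; rewrite s_mem.
apply=> [x|t1 u t2 e _]; first by rewrite s_mem; apply: w0.
exact: main e.
Qed.
End Heavy.

(** * Heavy independent sets at every scale *)
Section BigBack.
Variables (G : sgraph) (R : realType) (mu : R) (mu_ge0 : 0 <= mu).
Implicit Types (S : {set G}) (v : G).

(** If many neighbours of [v] are at least as heavy as [v], Turan's bound finds a large
    independent set among them: of size about [D] when they span few edges, and of
    size about [D ^+ 2 / tri S v] otherwise, where [tri S v <= wt mu S v]. *)
Lemma heavy_back S v (b : R) : v \in S ->
  let D := #|back S (wt mu S) v|%:R in
  b <= wt mu S v * D / 4 -> b <= D ^+ 2 / 8 ->
  exists I : {set G}, [/\ I \subset S, independent I &
     b <= \sum_(x in I) wt mu S x].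
Proof.
move=> vS; set B := back _ _ _ => D b1 b2.
have sB : B \subset nbr S v by apply/subsetP => x; rewrite inE => /andP[].
have [I [sI iI] cI] := independent_turan B.
exists I; split=> //; first exact: subset_trans sI (subset_trans sB (nbr_sub _ _)).
have wI : #|I|%:R * wt mu S v <= \sum_(x in I) wt mu S x.
  rewrite mulr_natl -sumr_const; apply: ler_sum => x /(subsetP sI).
  by rewrite inE => /andP[].
apply: le_trans wI.
set t := (\sum_(x in B) _)%N in cI.
have tw : t%:R <= wt mu S v :> R.
  apply: le_trans (_ : (tri S v)%:R <= _).
    by rewrite ler_nat; apply: sum_degS.
  by rewrite lerDl mulr_ge0.
move: cI; rewrite -(ler_nat R) !natrM natrD natrM -/D => cI.
have D0 : 0 <= D by apply: ler0n.
have I0 : 0 <= #|I|%:R :> R by apply: ler0n.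
have w0 := wt_ge0 mu_ge0 S v.
set i := #|I|%:R in cI I0 *; set w := wt _ _ _ in b1 tw w0 *; set t' := t%:R in cI tw.
case: (leP (2 * t') D) => cmp.
  case: (eqVneq D 0) => [De|Dn].
    by apply: le_trans b1 _; rewrite De mulr0 mul0r mulr_ge0.
  have Dp : 0 < D by rewrite lt0r Dn.
  have : D / 4 <= i.
    by rewrite ler_pdivrMr // -(ler_pM2r Dp); nra.
  by move=> h; apply: le_trans b1 _; nra.
apply: le_trans b2 _; rewrite ler_pdivrMr // expr2; nra.
Qed.
End BigBack.

(** The engine of the proof. If some vertex has too many neighbours that are at least
    as heavy, these contain the required set. Otherwise the random process with
    [p = P / rho] applies, in two regimes. A vertex of weight at least [rho] has
    [O(rho)] heavy neighbours, and [tri S v <= rho ^+ 2 / s ^+ 2] makes its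
    neighbourhood sparse by a constant factor, chosen as large as needed. A vertex of
    smaller weight may have [c1 * rho * l] heavy neighbours, since only the edge term
    bounds them, but lies in fewer than [rho] triangles; its neighbourhood is sparse
    by a power of [expR l], and the logarithm of that power pays for the factor [l]. *)
Lemma heavy_independent_exists (R : realType) (K delta : R) : 1 <= K -> 0 < delta <= 1 ->
  exists s M l0 : R, [/\ 1 <= s, 0 < M, 1 <= l0 &
    forall (l mu rho : R), l0 <= l -> M / l ^+ 2 <= mu ->
    expR (l * (5 / 8)) <= rho -> rho <= expR l ->
    forall (G : sgraph) (S : {set G}),
    {in S, forall v, (tri S v)%:R <= rho ^+ 2 / s ^+ 2} ->
    delta * rho ^+ 3 <= total_wt mu S ->
    exists I : {set G}, [/\ I \subset S, independent I &
      K * rho ^+ 2 <= \sum_(v in I) wt mu S v]].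
Proof.
move=> K1 /andP[d0 d1].
(* With [p = P / rho], half of [p * (delta * rho ^+ 3)] is [K * rho ^+ 2]. *)
pose P := 2 * K / delta; pose E : R := expR 2.
have E1 : 1 <= E by have := expR_ge1Dx (2 : R); rewrite -/E; lra.
have Pe : P = 2 * K / delta by [].
have Ee : expR 2 = E by [].
have P1 : 1 <= P by rewrite /P ler_pdivlMr // mul1r; lra.
clearbody P E.
have K0 : 0 < K by lra.
have P0 : 0 < P by lra.
have E0 : 0 < E by lra.
(* In the first regime [cap v / p] is [s / P], and [Z / 4] is [E * p * (4 * K * rho)]
   plus the bound [1] on [cap v ^+ 2 * tri S v]. *)
pose Z := 16 * E * P * K + 4.
have EPK : 0 < E * P * K by rewrite !mulr_gt0.
have Z0 : 0 < Z by rewrite /Z -!mulrA; lra.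
pose s := P * expR Z.
have eZ : 1 < expR Z by rewrite expR_gt1.
have sP : P < s by rewrite /s ltr_pMr.
have s0 : 0 < s by lra.
(* In the second regime [E * p * (c1 * rho * l)] is [l / 64], against a quarter of
   a logarithm of about [l / 8]. *)
pose c1 := (64 * E * P)^-1.
have c10 : 0 < c1 by rewrite invr_gt0 !mulr_gt0.
(* A vertex with [c1 * rho * l] neighbours has weight at least [mu * (c1 * rho * l)];
   this [M] makes Turan's bound among them yield [K * rho ^+ 2]. *)
pose M := 4 * K / c1 ^+ 2.
have M0 : 0 < M by rewrite divr_gt0 ?exprn_gt0 ?mulr_gt0.
have lnP : 0 <= ln P by rewrite ln_ge0.
have q0 : 0 < K / c1 ^+ 2 by rewrite divr_gt0 ?exprn_gt0.
exists s, M, (64 + 16 * ln P + 8 * s + 8 * (K / c1 ^+ 2)); split=> //; try lra.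
move=> l mu rho hl hmu rho_l rho_u G S htri htot.
have l1 : 64 <= l by lra.
have l_s : 8 * s <= l by lra.
have l_P : 64 + 16 * ln P <= l by lra.
have l_K : 8 * (K / c1 ^+ 2) <= l by lra.
have l0 : 0 < l by lra.
have rho0 : 0 < rho by apply: lt_le_trans rho_l; apply: expR_gt0.
have mu0 : 0 <= mu by apply: le_trans hmu; rewrite divr_ge0 ?exprn_ge0 ?ltW.
set w := wt mu S.
have w0 v : 0 <= w v by apply: wt_ge0.
have tw v : (tri S v)%:R <= w v by rewrite /w /wt lerDl mulr_ge0.
pose D v : R := #|back S w v|%:R.
have D0 v : 0 <= D v by apply: ler0n.
have Dw v : mu * D v <= w v.
  apply: le_trans (_ : mu * (deg S v)%:R <= _); last by rewrite /w /wt lerDr.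
  rewrite ler_wpM2l // ler_nat; apply/subset_leq_card/subsetP => x.
  by rewrite inE => /andP[].
pose big v := if rho <= w v then 4 * K * rho < D v else c1 * rho * l < D v.
case: (boolP [exists v in S, big v]) => [/exists_inP[v vS]|].
  rewrite /big; case: (leP rho (w v)) => [rw Db|wr Db].
    apply: (heavy_back mu0 vS); rewrite -/w -/(D v).
      rewrite ler_pdivlMr //.
      have : rho * (4 * K * rho) <= w v * D v.
        by apply: ler_pM rw (ltW Db); rewrite ltW ?mulr_gt0.
      lra.
    rewrite ler_pdivlMr //.
    have : (4 * K * rho) * (4 * K * rho) <= D v ^+ 2.
      by rewrite expr2; apply: ler_pM (ltW Db) (ltW Db); rewrite ltW ?mulr_gt0.
    have : 0 <= (K * rho ^+ 2) * (K - 1) by rewrite !mulr_ge0 ?exprn_ge0 ?subr_ge0 // ltW.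
    nra.
  have h0 : (c1 * rho * l) ^+ 2 <= D v ^+ 2.
    by apply: lerXn2r (ltW Db); rewrite nnegrE // ltW ?mulr_gt0.
  apply: (heavy_back mu0 vS); rewrite -/w -/(D v).
    rewrite ler_pdivlMr //.
    apply: le_trans (_ : mu * D v ^+ 2 <= _); last first.
      by rewrite expr2 mulrA ler_wpM2r.
    apply: le_trans (_ : M / l ^+ 2 * (c1 * rho * l) ^+ 2 <= _); last first.
      apply: ler_pM hmu h0; last exact: sqr_ge0.
      exact: divr_ge0 (ltW M0) (exprn_ge0 2 (ltW l0)).
    rewrite /M le_eqVlt; apply/orP; left; apply/eqP.
    by field; rewrite !gt_eqF.
  rewrite ler_pdivlMr //; apply: le_trans h0.
  have : 8 * (K / c1 ^+ 2) * (c1 ^+ 2 * rho ^+ 2) <= l ^+ 2 * (c1 ^+ 2 * rho ^+ 2).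
    apply: ler_wpM2r; first by rewrite -exprMn sqr_ge0.
    by apply: (le_trans l_K); rewrite expr2 ler_peMl //; lra.
  have -> : 8 * (K / c1 ^+ 2) * (c1 ^+ 2 * rho ^+ 2) = K * rho ^+ 2 * 8.
    by field; rewrite gt_eqF.
  by rewrite !exprMn; lra.
rewrite negb_exists_in => /forall_inP small.
pose p := P / rho; pose cap v := if rho <= w v then s / rho else expR (- (l / 2)).
have p0 : 0 < p by rewrite divr_gt0.
have h18 : expR (l / 8) <= rho * expR (- (l / 2)).
  have -> : l / 8 = l * (5 / 8) + - (l / 2) by lra.
  by rewrite expRD ler_pM2r ?expR_gt0.
have e18 : 1 + l / 8 <= expR (l / 8) by apply: expR_ge1Dx.
have s_cap : s / rho <= expR (- (l / 2)).
  by rewrite ler_pdivrMr // mulrC; lra.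
have p_s : p < s / rho by rewrite ltr_pM2r // invr_gt0.
have halfe : expR (- (l / 2)) <= 2^-1.
  rewrite expRN lef_pV2 ?posrE ?expR_gt0 //.
  by have := expR_ge1Dx (l / 2); lra.
have pcap v : p < cap v by rewrite /cap; case: ifP => _ //; apply: lt_le_trans s_cap.
have caph v : cap v <= 2^-1.
  by rewrite /cap; case: ifP => _ //; apply: le_trans s_cap halfe.
have capm u v : w v <= w u -> cap u <= cap v.
  move=> vu; rewrite /cap; case: (leP rho (w v)) => rv.
    by rewrite (le_trans rv vu).
  by case: ifP.
have w0S : {in S, forall v, 0 <= w v} by [].
have H : {in S, forall v, expR 2 * p * D v + cap v ^+ 2 * (tri S v)%:R
     <= ln (cap v / p) / 4}.
  move=> v vS; have := small _ vS; rewrite /big /cap.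
  case: (leP rho (w v)) => [rw|wr]; rewrite -leNgt => Db.
    have -> : s / rho / p = expR Z by rewrite /s /p; field; rewrite !gt_eqF.
    rewrite expRK.
    have t1 : expR 2 * p * D v <= 4 * (E * P * K).
      rewrite Ee.
      apply: le_trans (_ : E * p * (4 * K * rho) <= _).
        by rewrite ler_wpM2l // ltW // mulr_gt0.
      by rewrite le_eqVlt /p; apply/orP; left; apply/eqP; field; rewrite gt_eqF.
    have t2 : (s / rho) ^+ 2 * (tri S v)%:R <= 1.
      apply: le_trans (_ : (s / rho) ^+ 2 * (rho ^+ 2 / s ^+ 2) <= _).
        by rewrite ler_wpM2l ?exprn_ge0 ?htri // divr_ge0 ?ltW.
      by rewrite le_eqVlt; apply/orP; left; apply/eqP; field; rewrite !gt_eqF.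
    by rewrite /Z; lra.
  have t1 : expR 2 * p * D v <= l / 64.
    rewrite Ee.
    apply: le_trans (_ : E * p * (c1 * rho * l) <= _).
      by rewrite ler_wpM2l // ltW // mulr_gt0.
    by rewrite le_eqVlt /p /c1; apply/orP; left; apply/eqP; field; rewrite !gt_eqF.
  have t2 : expR (- (l / 2)) ^+ 2 * (tri S v)%:R <= 1.
    rewrite -expRM_natr (_ : - (l / 2) * 2 = - l); last by lra.
    rewrite expRN mulrC ler_pdivrMr ?expR_gt0 // mul1r.
    by apply: le_trans rho_u; apply: le_trans (tw v) (ltW wr).
  have t3 : l / 8 - ln P <= ln (expR (- (l / 2)) / p).
    have -> : l / 8 - ln P = ln (expR (l / 8) / P).
      by rewrite ln_div ?posrE ?expR_gt0 // expRK.
    rewrite ler_ln ?posrE ?divr_gt0 ?expR_gt0 //.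
    have -> : expR (- (l / 2)) / p = (rho * expR (- (l / 2))) / P.
      by rewrite /p; field; rewrite !gt_eqF.
    by rewrite ler_pM2r ?invr_gt0.
  lra.
have [I [sI iI hI]] := heavy_of_small_back p0 pcap caph capm w0S H.
exists I; split=> //; apply: le_trans hI.
apply: le_trans (_ : p / 2 * (delta * rho ^+ 3) <= _); last first.
  by rewrite ler_wpM2l // divr_ge0 // ltW.
by rewrite le_eqVlt /p Pe; apply/orP; left; apply/eqP; field; rewrite !gt_eqF.
Qed.

(** * Colouring vertex sets of bounded triangle degrees *)
Section Colour.
Variable R : realType.

Lemma exists_nat_ge (x : R) : 0 <= x -> exists2 n : nat, x <= n%:R & n%:R <= x + 1.
Proof.
move=> x0; exists (Num.truncn x).+1; have := truncn_itv x0; case/andP.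
  by move=> _ /ltW.
by move=> h _; rewrite -natr1 lerD2r.
Qed.

(** Only edges matter here: at total weight [expR (l * (15 / 8))] the degree sum is,
    for large [l], below the square of [eps * expR l]. *)
Lemma colorable_on_light (eps M : R) : 0 < eps -> 0 < M ->
  exists l0 : R, forall (l mu : R) k, l0 <= l -> M / l ^+ 2 <= mu ->
    (0 < k)%N -> eps * expR l <= k%:R ->
    forall (G : sgraph) (S : {set G}),
    total_wt mu S <= expR (l * (5 / 8)) ^+ 3 -> colorable_on S k.
Proof.
move=> e0 M0; pose q := M * eps ^+ 2.
have q0 : 0 < q by rewrite mulr_gt0 ?exprn_gt0.
exists (1 + 3072 / q) => l mu k hl hmu k0 hk G S htot.
have d0 : 0 < 3072 / q by rewrite divr_gt0.
have l1 : 1 <= l by apply: le_trans hl; rewrite lerDl ltW.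
have lq : 3072 / q <= l by apply: le_trans hl; rewrite lerDr.
have l0 : 0 < l by apply: lt_le_trans l1.
apply: colorable_on_edges k0 _; rewrite -(ler_nat R) natrM.
set d := (\sum_(x in S) deg S x)%N.
have h1 : M / l ^+ 2 * d%:R <= expR (l * (5 / 8)) ^+ 3.
  apply: le_trans htot; apply: le_trans (_ : mu * d%:R <= _).
    by rewrite ler_wpM2r.
  rewrite /total_wt /wt big_split /= -mulr_sumr /d natr_sum lerDr.
  by apply: sumr_ge0.
have h2 : l ^+ 2 <= q * expR (l / 8).
  have := @expR_ge1Dxn R (l / 8) 2; rewrite (_ : 3`! = 6)%N //.
  move=> /(_ _) h; have {}h : (l / 8) ^+ 3 / 6 <= expR (l / 8).
    by apply: le_trans (h _); [rewrite lerDr | rewrite divr_ge0 // ltW].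
  have : q * ((l / 8) ^+ 3 / 6) <= q * expR (l / 8) by rewrite ler_pM2l.
  apply: le_trans; rewrite expr_div_n.
  have : 3072 <= q * l by rewrite mulrC -ler_pdivrMr.
  move=> h3; have : 3072 * l ^+ 2 <= q * l * l ^+ 2.
    by rewrite ler_pM2r ?exprn_gt0.
  rewrite !exprS !expr0; lra.
have h3 : (eps * expR l) * (eps * expR l) <= k%:R * k%:R.
  by rewrite ler_pM // mulr_ge0 ?expR_ge0 ?(ltW e0).
apply: le_trans h3.
have : M / l ^+ 2 * d%:R * l ^+ 2 <= expR (l * (5 / 8)) ^+ 3 * (q * expR (l / 8)).
  apply: ler_pM => //; last by rewrite sqr_ge0.
  by rewrite mulr_ge0 ?divr_ge0 ?(ltW M0) ?sqr_ge0.
have -> : M / l ^+ 2 * d%:R * l ^+ 2 = M * d%:R by field; rewrite gt_eqF.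
have -> : expR (l * (5 / 8)) ^+ 3 * (q * expR (l / 8)) =
    M * ((eps * expR l) * (eps * expR l)).
  have -> : (eps * expR l) * (eps * expR l) = eps ^+ 2 * expR (l + l).
    by rewrite expRD; ring.
  have -> : l + l = l * (5 / 8) * 3%:R + l / 8 by lra.
  by rewrite expRD expRM_natr /q; ring.
by rewrite ler_pM2l.
Qed.

(** One colour lowers the total weight from [rho ^+ 3] to [(rho - kap) ^+ 3]: either
    some vertex lies in so many triangles that it is heavy enough as a colour class on
    its own, or no vertex does and [heavy_independent_exists] applies. So [O(rho)]
    colours reach the level of [colorable_on_light]. *)
Lemma colorable_on_cube : exists A M : R, [/\ 1 <= A, 0 < M &
  forall eps : R, 0 < eps -> exists l0 : R, forall l mu rho : R,
    l0 <= l -> M / l ^+ 2 <= mu -> 0 <= rho -> rho <= expR l / 2 ->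
    forall (G : sgraph) (S : {set G}), total_wt mu S <= rho ^+ 3 ->
    exists2 k, colorable_on S k & k%:R <= A * rho + eps * expR l].
Proof.
have [||s [M [l1 [s1 M0 l11 U]]]] := @heavy_independent_exists R 1 8^-1; [lra|lra|].
have s0 : 0 < s by lra.
have s21 : 1 <= s ^+ 2 by rewrite exprn_ege1.
have s20 : 0 < s ^+ 2 by lra.
exists (3 * s ^+ 2), M; split=> //; first by lra.
move=> eps e0.
have e20 : 0 < eps / 2 by lra.
have [l2 base] := colorable_on_light e20 M0.
have d0 : 0 < 4 / eps by rewrite divr_gt0.
exists (l1 + `|l2| + 16 + 4 / eps) => l mu rho hl hmu rho0 rhol G S htot.
have hl2 := ler_norm l2.
have l2' := normr_ge0 l2.
have l16 : 16 <= l by lra.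
have ll1 : l1 <= l by lra.
have ll2 : l2 <= l by lra.
have lle : 4 / eps <= l by lra.
have el0 : 0 < expR l by apply: expR_gt0.
have mu0 : 0 <= mu.
  by apply: le_trans hmu; rewrite divr_ge0 ?sqr_ge0 // ltW.
(* Any exponent strictly between [1 / 2] and [2 / 3] would serve: the cap
   [expR (- (l / 2))] must exceed [p] by a power of [expR l], and the cube of [r0]
   must stay below [expR (l * 2)]. *)
pose r0 := expR (l * (5 / 8)).
have r01 : 1 <= r0 by rewrite -expR0 ler_expR; lra.
have r0l : 4 * r0 <= expR l.
  have -> : expR l = r0 * expR (l * (3 / 8)).
    by rewrite -expRD; congr expR; lra.
  rewrite mulrC ler_pM2l ?expR_gt0 //.
  have := expR_ge1Dx (l * (3 / 8)); lra.
have eel : 4 <= eps * expR l.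
  rewrite mulrC -ler_pdivrMr //; have := expR_ge1Dx l; lra.
(* The weight [t ^+ 2 / s ^+ 2] of a single vertex in many triangles equals
   [3 * kap * t ^+ 2], a bound on the drop from [t ^+ 3] to [(t - kap) ^+ 3]. *)
pose kap := (3 * s ^+ 2)^-1.
have kap0 : 0 < kap by rewrite invr_gt0; lra.
have kapE : 3 * kap = (s ^+ 2)^-1 by rewrite /kap; field; rewrite gt_eqF.
have kap1 : 3 * kap <= 1 by rewrite kapE invf_le1.
have [k0 k0a k0b] := exists_nat_ge (ltW (mulr_gt0 e20 el0)).
have k00 : (0 < k0)%N.
  by rewrite -(ltr_nat R); apply: lt_le_trans k0a; apply: mulr_gt0.
have rk0 : 0 <= rho / kap by rewrite divr_ge0 // ltW.
have [n na nb] := exists_nat_ge rk0.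
exists (n + k0)%N; last first.
  have : n%:R <= 3 * s ^+ 2 * rho + 1.
    by apply: le_trans nb _; rewrite /kap invrK mulrC.
  by rewrite natrD; lra.
pose a m := (r0 + m%:R * kap) ^+ 3.
have nk : n%:R * kap <= rho + kap.
  apply: le_trans (_ : (rho / kap + 1) * kap <= _); first by rewrite ler_pM2r.
  by rewrite mulrDl mul1r divfK // gt_eqF.
have nk' : rho <= n%:R * kap by rewrite -ler_pdivrMr.
apply: (@colorable_on_greedy G R mu mu0 (fun=> True) k0 n a S) => //.
- move=> A _; rewrite /a mul0r addr0; apply: base => //.
- move=> A m _ mn /andP[pa pb].
  pose t := r0 + m.+1%:R * kap.
  have mk : m%:R * kap >= 0 by rewrite mulr_ge0 // ltW.
  have tE : t = r0 + m%:R * kap + kap by rewrite /t -natr1; ring.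
  have t_l : t <= expR l.
    have : m.+1%:R * kap <= n%:R * kap by rewrite ler_pM2r // ler_nat.
    rewrite /t; lra.
  have t0 : r0 <= t by rewrite tE -addrA lerDl addr_ge0 // ltW.
  have tp : 0 < t by apply: lt_le_trans t0; apply: expR_gt0.
  have step : a m.+1 - a m <= 3 * kap * t ^+ 2.
    rewrite /a -/t (_ : r0 + _ = t - kap); last by rewrite tE; ring.
    have : kap ^+ 2 * (3 * t - kap) >= 0 by rewrite mulr_ge0 ?sqr_ge0 //; lra.
    move=> hk; rewrite -subr_ge0 (_ : 3 * kap * t ^+ 2 - _ = kap ^+ 2 * (3 * t - kap)) //.
    by ring.
  have t20 : 0 < t ^+ 2 by apply: exprn_gt0.
  have k3t : 3 * kap * t ^+ 2 = t ^+ 2 / s ^+ 2.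
    by rewrite kapE mulrC.
  case: (boolP [exists v in A, t ^+ 2 / s ^+ 2 < (tri A v)%:R]).
    case/exists_inP => v vA tv; exists [set v]; split.
    + by rewrite sub1set.
    + exact: independent1.
    + rewrite big_set1; apply: le_trans step _; rewrite k3t.
      by apply: le_trans (ltW tv) _; rewrite /wt lerDl mulr_ge0.
  rewrite negb_exists_in => /forall_inP small.
  have small' : {in A, forall v, (tri A v)%:R <= t ^+ 2 / s ^+ 2}.
    by move=> v vA; rewrite leNgt small.
  have t8 : 8^-1 * t ^+ 3 <= total_wt mu A.
    apply: ltW; apply: le_lt_trans pa; rewrite /a.
    have -> : 8^-1 * t ^+ 3 = (t / 2) ^+ 3 by field.
    apply: lerXn2r; rewrite ?nnegrE ?addr_ge0 ?expR_ge0 //; first lra.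
    by clear - tE mk kap1 r01 kap0; lra.
  have [I [sI iI hI]] := U l mu t ll1 hmu t0 t_l G A small' t8.
  exists I; split=> //; apply: le_trans step _; apply: le_trans hI.
  by rewrite ler_pM2r.
apply: le_trans htot _; apply: lerXn2r; rewrite ?nnegrE //.
  by rewrite addr_ge0 ?expR_ge0 // (le_trans rho0).
by apply: le_trans nk' _; rewrite lerDr expR_ge0.
Qed.


(** Spending colours on classes of weight [K * r ^+ 2] with [K] large brings the total
    weight from [5 * r ^+ 3] down to [(g * r) ^+ 3] within a small multiple of [r]
    steps; for small [g], [colorable_on_cube] then needs few colours as well. *)
Lemma colorable_on_sparse (eps : R) : 0 < eps <= 1 ->
  exists s M l0 : R, [/\ 1 <= s, 0 < M, 1 <= l0 & forall l mu : R,
    l0 <= l -> M / l ^+ 2 <= mu -> forall (G : sgraph) (S : {set G}),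
    {in S, forall v, (tri S v)%:R <= expR l ^+ 2 / s ^+ 2} ->
    total_wt mu S <= 5 * expR l ^+ 3 ->
    exists2 k, colorable_on S k & k%:R <= eps * expR l].
Proof.
move=> /andP[e0 e1].
have [A [M1 [A1 M10 C]]]  := colorable_on_cube.
have A0 : 0 < A by lra.
pose g := eps / (4 * A).
have g0 : 0 < g by rewrite divr_gt0 ?mulr_gt0.
have gA : A * g = eps / 4 by rewrite /g; field; rewrite gt_eqF.
have g4 : g <= 4^-1 by nra.
clearbody g.
pose K := 20 / eps.
have K1 : 1 <= K by rewrite ler_pdivlMr //; lra.
have K0 : 0 < K by lra.
have d01 : 0 < g ^+ 3 <= 1.
  by rewrite exprn_gt0 //= exprn_ile1 //; lra.
have [s [M2 [l1 [s1 M20 l11 U]]]] := heavy_independent_exists K1 d01.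
have e40 : 0 < eps / 4 by lra.
have [l2 {}C] := C _ e40.
have d0 : 0 < 4 / eps by rewrite divr_gt0.
exists s, (M1 + M2), (l1 + `|l2| + 4 / eps); split=> //; try lra.
  by have := normr_ge0 l2; lra.
move=> l mu hl hmu G S htri htot.
have hl2 := ler_norm l2.
have l2' := normr_ge0 l2.
have ll1 : l1 <= l by lra.
have ll2 : l2 <= l by lra.
have lle : 4 / eps <= l by lra.
have el0 : 0 < expR l by apply: expR_gt0.
have lp : 0 < l by lra.
have mu1 : M1 / l ^+ 2 <= mu.
  by apply: le_trans hmu; rewrite ler_pM2r ?invr_gt0 ?exprn_gt0 //; lra.
have mu2 : M2 / l ^+ 2 <= mu.
  by apply: le_trans hmu; rewrite ler_pM2r ?invr_gt0 ?exprn_gt0 //; lra.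
have mu0 : 0 <= mu.
  by apply: le_trans mu1; rewrite divr_ge0 ?sqr_ge0 // ltW.
have eel : 4 <= eps * expR l.
  by rewrite mulrC -ler_pdivrMr //; have := expR_ge1Dx l; lra.
set r := expR l in htri htot el0 eel *.
have b0 : 0 <= A * (g * r) + eps / 4 * r.
  apply: addr_ge0; apply: mulr_ge0; rewrite ?(ltW A0) ?(ltW e40) ?(ltW el0) //.
  exact: mulr_ge0 (ltW g0) (ltW el0).
pose k := Num.truncn (A * (g * r) + eps / 4 * r).
have kb : k%:R <= A * (g * r) + eps / 4 * r.
  by have /andP[] := truncn_itv b0.
have n0 : 0 <= 5 * r / K.
  by apply: divr_ge0 (ltW K0); apply: mulr_ge0 (ltW el0).
have [n na nb] := exists_nat_ge n0.
exists (n + k)%N; last first.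
  rewrite natrD; move: nb kb; rewrite mulrA gA /K.
  rewrite (_ : 5 * r / (20 / eps) = eps / 4 * r); last by field; rewrite gt_eqF.
  lra.
pose a m := (g * r) ^+ 3 + m%:R * (K * r ^+ 2).
have Kr : 0 < K * r ^+ 2 by rewrite mulr_gt0 ?exprn_gt0.
pose P (A : {set G}) := {in A, forall v, (tri A v)%:R <= r ^+ 2 / s ^+ 2}.
apply: (@colorable_on_greedy G R mu mu0 P k n a S) => //.
- move=> B B' sB hB v vB; apply: le_trans (hB v (subsetP sB v vB)).
  by rewrite ler_nat triS.
- move=> B _; rewrite /a mul0r addr0 => hB.
  have gr0 : 0 <= g * r by rewrite mulr_ge0 ?ltW.
  have gr2 : g * r <= expR l / 2 by rewrite -/r; nra.
  have [k' ck' kk'] := C l mu (g * r) ll2 mu1 gr0 gr2 G B hB.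
  apply: colorable_on_mono ck'; rewrite -(ler_nat R).
  by rewrite ler_nat truncn_ge_nat.
- move=> B m PB mn /andP[pa _].
  have r0l : expR (l * (5 / 8)) <= r by rewrite ler_expR; lra.
  have rr : r <= expR l by [].
  have pd : g ^+ 3 * r ^+ 3 <= total_wt mu B.
    rewrite -exprMn; apply: ltW; apply: le_lt_trans pa.
    by rewrite /a lerDl mulr_ge0 // ltW.
  have [I [sI iI hI]] := U l mu r ll1 mu2 r0l rr G B PB pd.
  exists I; split=> //; apply: le_trans hI.
  by rewrite /a -natr1 le_eqVlt; apply/orP; left; apply/eqP; ring.
apply: le_trans htot _; rewrite /a.
have : 5 * r <= n%:R * K by rewrite -ler_pdivrMr.
move=> h; have : 5 * r * r ^+ 2 <= n%:R * K * r ^+ 2.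
  by rewrite ler_pM2r ?exprn_gt0.
have : 0 <= (g * r) ^+ 3 by rewrite exprn_ge0 // mulr_ge0 ?ltW.
rewrite (exprS r 2); lra.
Qed.
End Colour.

(** * Back to the whole graph *)
Section Global.
Variable G : sgraph.
Implicit Types (S T A : {set G}) (v x y : G).

Lemma deg_sum S v : deg S v = (\sum_(x in S) adj v x)%N.
Proof.
rewrite /deg -sum1_card big_mkcond [RHS]big_mkcond /=.
by apply: eq_bigr => x _; rewrite inE; case: (x \in S) => //=; case: (adj v x).
Qed.

Lemma card_sum A : (\sum_x (x \in A))%N = #|A|.
Proof.
rewrite -sum1_card [RHS]big_mkcond /=.
by apply: eq_bigr => x _; case: (x \in A).
Qed.

(** Each edge, as a set of at most two vertices, holds at most [2 * 2] ordered pairs. *)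
Lemma sum_deg_edges : (\sum_v deg [set: G] v <= 4 * #|edges G|)%N.
Proof.
have -> : (\sum_v deg [set: G] v = \sum_(v : G) \sum_(x : G) @adj G v x)%N.
  by apply: eq_bigr => v _; rewrite deg_sum; apply: eq_bigl => x; rewrite inE.
apply: (@leq_trans (\sum_v \sum_x \sum_(A in edges G) (v \in A) * (x \in A))%N).
  apply: leq_sum => v _; apply: leq_sum => x _.
  case vx: (adj v x) => //.
  have eA : [set v; x] \in edges G by apply/imsetP; exists (v, x).
  by rewrite (bigD1 _ eA) /= !inE !eqxx orbT.
have -> : (\sum_v \sum_x \sum_(A in edges G) (v \in A) * (x \in A) =
   \sum_(A in edges G) #|A| * #|A|)%N.
  under eq_bigr do rewrite exchange_big /=.
  rewrite exchange_big /=; apply: eq_bigr => A _.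
  by rewrite -card_sum big_distrl /=; apply: eq_bigr => v _; rewrite big_distrr.
rewrite mulnC -sum_nat_const; apply: leq_sum => A /imsetP[[v x] _ ->] /=.
by rewrite (@leq_mul _ _ 2 2) // cards2; case: (v != x).
Qed.

(** Each triangle holds [3 * 3 * 3] ordered triples of vertices, which is a generous but
    sufficient count of those with distinct entries. *)
Lemma sum_tri_triangles : (\sum_v tri [set: G] v <= 27 * #|triangles G|)%N.
Proof.
have triE v : (tri [set: G] v =
    \sum_x \sum_y (adj v x && adj v y && adj x y))%N.
  rewrite /tri big_mkcond /=; apply: eq_bigr => x _; rewrite !inE /=.
  case: (adj v x) => /=; last by rewrite big1.
  rewrite deg_sum big_mkcond /=; apply: eq_bigr => y _; rewrite !inE /=.
  by case: (adj v y).
under eq_bigr do rewrite triE.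
apply: (@leq_trans (\sum_v \sum_x \sum_y \sum_(A in triangles G)
    (v \in A) * ((x \in A) * (y \in A)))%N).
  apply: leq_sum => v _; apply: leq_sum => x _; apply: leq_sum => y _.
  case h: (_ && _ && _) => //; move/andP: h => [/andP[vx vy] xy].
  have neq (a b : G) : adj a b -> a != b by apply: contraTneq => ->; rewrite adj_irr.
  have eA : [set v; x; y] \in triangles G.
    rewrite inE; apply/andP; split.
      by rewrite setUC cardsU1 cards2 !inE eq_sym (neq _ _ vx) ![y == _]eq_sym
        negb_or (neq _ _ vy) (neq _ _ xy).
    apply/forall_inP => a; rewrite !inE => ha; apply/forall_inP => b.
    rewrite !inE => hb; apply/implyP.
    by case/orP: ha => [/orP[]|] /eqP->; case/orP: hb => [/orP[]|] /eqP->;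
      rewrite ?eqxx // adj_sym.
  by rewrite (bigD1 _ eA) /= !inE !eqxx !orbT.
have -> : (\sum_v \sum_x \sum_y \sum_(A in triangles G)
    (v \in A) * ((x \in A) * (y \in A)) =
   \sum_(A in triangles G) #|A| * (#|A| * #|A|))%N.
  under eq_bigr do under eq_bigr do rewrite exchange_big /=.
  under eq_bigr do rewrite exchange_big /=.
  rewrite exchange_big /=; apply: eq_bigr => A _.
  rewrite -card_sum big_distrl /=; apply: eq_bigr => v _.
  rewrite big_distrl big_distrr /=; apply: eq_bigr => x _.
  by rewrite !big_distrr.
rewrite mulnC -sum_nat_const; apply: leq_sum => A.
by rewrite inE => /andP[/eqP-> _].
Qed.

Lemma colorable_of_on k : colorable_on [set: G] k -> colorable G k.
Proof.
case=> f [f1 f2].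
have fk x : (f x < k)%N by apply: f1; rewrite inE.
apply/existsP; exists [ffun x => Ordinal (fk x)].
apply/forallP => x; apply/forallP => y; apply/implyP => xy.
by rewrite !ffunE; apply/eqP => /(congr1 val) /=; apply: f2; rewrite ?inE.
Qed.

Lemma chromatic_number_le k : colorable_on [set: G] k -> (chromatic_number G <= k)%N.
Proof.
by move=> /colorable_of_on ck; rewrite /chromatic_number; case: ex_minnP => m _; apply.
Qed.

Lemma colorable_on_chromatic S : colorable_on S (chromatic_number (induced_subgraph S)).
Proof.
rewrite /chromatic_number; case: ex_minnP => m /existsP[f hf] _.
case: m => [|m] in f hf *.
  exists (fun=> 0%N); split.
    by move=> x xS; case: (f (exist _ x xS)).
  by move=> x y xS; case: (f (exist _ x xS)).
exists (fun x => if insub x is Some u then f u : nat else 0%N); split.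
  by move=> x _; case: insubP.
move=> x y xS yS xy; case: insubP => [u _ ux|]; last by rewrite xS.
case: insubP => [w _ wy|]; last by rewrite yS.
move/forallP: hf => /(_ u) /forallP /(_ w) /implyP.
rewrite /= /induced_adj ux wy => /(_ xy) /eqP fN e.
by apply: fN; apply: val_inj.
Qed.

Lemma independence_induced S K :
  (forall J : {set G}, J \subset S -> independent J -> (#|J| <= K)%N) ->
  (independence_number (induced_subgraph S) <= K)%N.
Proof.
move=> h; apply/bigmax_leqP => J iJ.
rewrite -(card_imset _ val_inj); apply: h.
  by apply/subsetP => _ /imsetP[x _ ->]; apply: valP.
apply/independentP => _ _ /imsetP[x xJ ->] /imsetP[y yJ ->].
by move/independentP: iJ => /(_ _ _ xJ yJ).
Qed.

(** Removing disjoint independent sets of more than [K] vertices while there are any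
    costs one colour per more than [K] vertices removed. *)
Lemma peel_independent K T : exists (H : {set G}) q, [/\ H \subset T,
  forall J : {set G}, J \subset H -> independent J -> (#|J| <= K)%N,
  (q * K <= #|T|)%N & forall m, colorable_on H m -> colorable_on T (q + m)].
Proof.
elim: {T}_.+1 {-2}T (ltnSn #|T|) => // n IH T; rewrite ltnS => cT.
case: (boolP [exists J : {set G}, [&& J \subset T, independent J & (K < #|J|)%N]]).
  case/existsP => J /and3P[sJ iJ KJ].
  have eT : (#|T| = #|J| + #|T :\: J|)%N by rewrite -(cardsID J) (setIidPr sJ).
  have [|H [q [sH aH qH cH]]] := IH (T :\: J).
    by apply: leq_trans cT; rewrite eT -[X in (X < _)%N]add0n ltn_add2r; case: #|J| KJ.
  exists H, q.+1; split=> //.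
  - exact: subset_trans sH (subsetDl _ _).
  - by rewrite mulSn eT leq_add // ltnW.
  - by move=> m /cH; rewrite addSn; apply: colorable_on_rm.
move=> h; exists T, 0%N; split=> // J sJ iJ; rewrite leqNgt.
by apply: contra h => KJ; apply/existsP; exists J; rewrite sJ iJ.
Qed.
End Global.

Lemma bin3_le (R : realType) r : 6 * ('C(r, 3))%:R <= r%:R ^+ 3 :> R.
Proof.
rewrite -natrX -[6]/(6%:R) -natrM ler_nat mulnC -[6%N]/(3`!) bin_ffact.
by rewrite !ffactnS ffactn0 muln1 !expnS expn0 muln1; nia.
Qed.

Theorem theorem1p2 (R : realType) (eta : R) (eta_gt0 : 0 < eta) :
  exists (c L : R) (K r0 : nat), [/\ 0 < c, 0 < L &
    forall r : nat, (r0 <= r)%N ->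
    forall G : sgraph,
      (r <= chromatic_number G)%N ->
      #|edges G|%:R <= c * r%:R ^+ 3 * ln (r%:R : R) ^+ 2 ->
      (#|triangles G| < 'C(r, 3))%N ->
      exists S : {set G},
        [/\ (1 - eta) * r%:R <= (chromatic_number (induced_subgraph S))%:R,
            #|induced_subgraph S|%:R <= L * r%:R
          & (independence_number (induced_subgraph S) <= K)%N]].
Proof.
pose eps : R := Num.min 1 eta / 2.
have m0 : 0 < Num.min 1 eta by rewrite lt_min ltr01.
have m1 : Num.min 1 eta <= 1 by rewrite ge_min lexx.
have me : Num.min 1 eta <= eta by rewrite ge_min lexx orbT.
have e01 : 0 < eps <= 1 by rewrite /eps; apply/andP; split; lra.
have e0 : 0 < eps by case/andP: e01.
have e2 : 2 * eps <= eta by rewrite /eps; lra.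
clearbody eps.
have [s [M [l0 [s1 M0 l01 colour]]]] := colorable_on_sparse e01.
have s20 : 0 < s ^+ 2 by rewrite exprn_gt0 //; lra.
have [K KL _] : exists2 K : nat, 5 * s ^+ 2 / eps <= K%:R & K%:R <= 5 * s ^+ 2 / eps + 1.
  by apply: exists_nat_ge; apply: divr_ge0 (ltW e0); apply: mulr_ge0 (ltW s20).
have [r0 r0l _] := exists_nat_ge (expR_ge0 l0).
exists (1 / (8 * M)), (5 * s ^+ 2), K, r0; split;
  [by rewrite divr_gt0 ?mulr_gt0 | exact: mulr_gt0 s20 |].
move=> r rr0 G chi edgeG triG.
have er : expR l0 <= r%:R by apply: le_trans r0l _; rewrite ler_nat.
have rp : 0 < r%:R :> R by apply: lt_le_trans er; apply: expR_gt0.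
set l := ln (r%:R : R) in edgeG.
have rE : r%:R = expR l by rewrite lnK ?posrE.
have ll : l0 <= l by rewrite -ler_expR -rE.
have lp : 0 < l by apply: lt_le_trans ll; lra.
pose mu := M / l ^+ 2.
have mu0 : 0 <= mu by rewrite divr_ge0 ?sqr_ge0 // ltW.
have tri_le : (\sum_v tri [set: G] v)%:R <= 9 / 2 * r%:R ^+ 3 :> R.
  apply: le_trans (_ : 27 * ('C(r, 3))%:R <= _).
    rewrite -natrM ler_nat; apply: leq_trans (sum_tri_triangles G) _.
    by rewrite leq_mul2l ltnW // orbT.
  by have := bin3_le R r; lra.
have total_le : total_wt mu [set: G] <= 5 * r%:R ^+ 3.
  rewrite /total_wt /wt big_split /= -mulr_sumr.
  have -> : \sum_(i in [set: G]) (tri [set: G] i)%:R = (\sum_v tri [set: G] v)%:R :> R.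
    by rewrite natr_sum; apply: eq_bigl => x; rewrite inE.
  have -> : \sum_(i in [set: G]) (deg [set: G] i)%:R = (\sum_v deg [set: G] v)%:R :> R.
    by rewrite natr_sum; apply: eq_bigl => x; rewrite inE.
  have h : mu * (\sum_v deg [set: G] v)%:R <= r%:R ^+ 3 / 2.
    apply: le_trans (_ : mu * (4 * #|edges G|%:R) <= _).
      by rewrite ler_wpM2l // -natrM ler_nat sum_deg_edges.
    apply: le_trans (_ : mu * (4 * (1 / (8 * M) * r%:R ^+ 3 * l ^+ 2)) <= _).
      by rewrite ler_wpM2l // ler_pM2l.
    by rewrite le_eqVlt /mu; apply/orP; left; apply/eqP; field; rewrite !gt_eqF.
  by apply: le_trans (lerD tri_le h) _; lra.
(* Everything outside this set of [O(r)] vertices takes at most [eps * r] colours. *)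
pose T := [set v | r%:R ^+ 2 / s ^+ 2 < (tri [set: G] v)%:R :> R].
have cT : #|T|%:R <= 5 * s ^+ 2 * r%:R :> R.
  have h : #|T|%:R * (r%:R ^+ 2 / s ^+ 2) <= 5 * r%:R ^+ 3.
    apply: le_trans (_ : (\sum_v tri [set: G] v)%:R <= _); last first.
      by apply: le_trans tri_le _; rewrite ler_wpM2r ?exprn_ge0 //; lra.
    rewrite mulr_natl -sumr_const natr_sum [leLHS]big_mkcond /=.
    apply: ler_sum => v _; rewrite inE; case: ifP => [/ltW //|_].
    exact: ler0n.
  have r2 : 0 < r%:R ^+ 2 / s ^+ 2 :> R by apply: divr_gt0 s20; apply: exprn_gt0.
  rewrite -(ler_pM2r r2); apply: le_trans h _.
  rewrite le_eqVlt; apply/orP; left; apply/eqP; field.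
  by rewrite gt_eqF //; lra.
have [|| k ck kb] := colour l mu ll (lexx _) G (~: T).
- move=> v; rewrite !inE -leNgt -rE; apply: le_trans.
  by rewrite ler_nat triS // subsetT.
- by rewrite -rE; apply: le_trans (total_wtS mu0 (subsetT _)) total_le.
have [H [q [sH aH qK cH]]] := peel_independent K T.
exists H; split.
- set m := chromatic_number _.
  have colG : colorable_on [set: G] (q + m + k).
    by rewrite -(setUCr T); apply: colorable_on_U ck; apply/cH/colorable_on_chromatic.
  have := leq_trans chi (chromatic_number_le colG).
  rewrite -(ler_nat R) !natrD => hr.
  have hq : q%:R <= eps * r%:R.
    have Kp : 0 < K%:R :> R.
      by apply: lt_le_trans KL; apply: divr_gt0 e0; apply: mulr_gt0 s20.
    rewrite -(ler_pM2r Kp); apply: le_trans (_ : #|T|%:R <= _).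
      by rewrite -natrM ler_nat.
    apply: (le_trans cT); move: KL; rewrite ler_pdivrMr // => KL.
    have : 5 * s ^+ 2 * r%:R <= K%:R * eps * r%:R by rewrite ler_pM2r.
    lra.
  rewrite -rE in kb.
  have : 2 * eps * r%:R <= eta * r%:R by rewrite ler_pM2r.
  lra.
- rewrite card_sig; apply: le_trans cT; rewrite ler_nat.
  by apply: leq_trans (subset_leq_card sH); rewrite cardE.
- exact: independence_induced.
Qed.
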